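(* Let $\mu_1, \mu_2 \ge 0$ be such that $\mu_1+\mu_2>0$. Let $x_1^\star\neq x_2^\star$ be two points of $\mathbb{R}^n$ and let $B$ be a real number satisfying $B\geq \frac{\mu_1\mu_2}{\mu_1+\mu_2}\|x_1^\star-x_2^\star\|$. A point $x^\star \in \mathbb{R}^n$ is a minimizer of the sum $f_1(x)+f_2(x)$ for some functions $f_1\in\mathcal{M}_{\mu_1,\infty}(x_1^\star)$, $f_2\in\mathcal{M}_{\mu_2,\infty}(x_2^\star)$ for which there is a vector $g$ with $g\in\partial f_1(x^\star)$, $-g\in\partial f_2(x^\star)$ and $\|g\|\le B$, if and only if it satisfies $$\mu_1\|x^\star-x_1^\star\|\leq B \quad\text{and}\quad \mu_2\|x^\star-x_2^\star\|\leq B$$ and at least one of the following additional inequalities: (i) $\mu_1 \langle x_1^\star-x^\star, x^\star-x_2^\star \rangle \geq \mu_2 \| x^\star-x_2^\star \|^2$; (ii) $\mu_2 \langle x_2^\star-x^\star, x^\star-x_1^\star \rangle \geq \mu_1 \| x^\star-x_1^\star \|^2$; (iii) $x^\star\ne x_1^\star$, $x^\star\neq x_2^\star$ and $\det\left(M(x^\star, x_1^\star, x_2^\star, B^2)\right)\geq 0$, where $$M(x^\star,x_1^\star,x_2^\star,\alpha)=\begin{pmatrix} 1 & \frac{\langle x^\star-x_1^\star, x^\star-x_2^\star \rangle}{\|x^\star-x_1^\star\| \|x^\star-x_2^\star\|} & \mu_1\|x^\star-x_1^\star\| \\ \frac{\langle x^\star-x_1^\star, x^\star-x_2^\star \rangle}{\|x^\star-x_1^\star\|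 \|x^\star-x_2^\star\|} & 1 & -\mu_2\|x^\star-x_2^\star\| \\ \mu_1\|x^\star-x_1^\star\| & -\mu_2\|x^\star-x_2^\star\| & \alpha \end{pmatrix}.$$
   Context: $\|\cdot\|$ and $\langle\cdot,\cdot\rangle$ are the Euclidean norm and dot product on $\mathbb{R}^n$. For a convex $f:\mathbb{R}^n\to(-\infty,\infty]$ and $x\in\mathrm{dom}\, f=\{x:f(x)<\infty\}$, $\partial f(x)=\{g: f(y)\ge f(x)+\langle g,y-x\rangle\ \forall y\in\mathbb{R}^n\}$. $f$ is $\mu$-strongly convex ($\mu\ge 0$) if $x\mapsto f(x)-\frac{\mu}{2}\|x\|^2$ is convex. $\mathcal{F}_{\mu,\infty}(\mathbb{R}^n)$ is the set of closed proper convex functions $\mathbb{R}^n\to(-\infty,\infty]$ that are $\mu$-strongly convex (no smoothness is required), and $\mathcal{M}_{\mu,\infty}(z)$ is the set of functions in $\mathcal{F}_{\mu,\infty}(\mathbb{R}^n)$ for which $z$ is a (global) minimizer. *)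

(* Defs.v *)
From HB Require Import structures.
From mathcomp Require Import all_boot all_order all_algebra.
From mathcomp Require Import all_classical all_reals all_analysis.
Import Order.TTheory GRing.Theory Num.Theory.
Import numFieldNormedType.Exports.

Set Implicit Arguments.
Unset Strict Implicit.
Unset Printing Implicit Defensive.

Local Open Scope classical_set_scope.
Local Open Scope ring_scope.

Section Defs.
Context {R : realType} {n : nat}.
Implicit Types (x y z g u v : 'rV[R]_n) (f : 'rV[R]_n -> \bar R) (mu : R).

Definition dot u v : R := \sum_(i < n) u 0 i * v 0 i.

(* Not the library's norm `|u| on row vectors, which is the max-norm. *)
Definition enorm u : R := Num.sqrt (dot u u).

Definition edom f : set 'rV[R]_n := [set x | (f x < +oo)%E].

Definition eproper f : Prop := (forall x, f x != -oo%E) /\ edom f !=set0.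

(* The library's topology on row vectors is the product topology,
   i.e. the Euclidean one. *)
Definition eclosed f : Prop :=
  closed [set p : 'rV[R]_n * R | (f p.1 <= p.2%:E)%E].

(* Only used for functions that never take the value -oo, so that the sum
   on the right is unambiguous; t ranges over the open interval to avoid
   0 * +oo. *)
Definition econvex f : Prop :=
  forall x y (t : R), 0 < t < 1 ->
    (f (t *: x + (1 - t) *: y)%R <= t%:E * f x + (1 - t)%:E * f y)%E.

Definition strongly_convex mu f : Prop :=
  econvex (fun x => f x - (mu / 2 * enorm x ^+ 2)%:E)%E.

Definition minimizer f z : Prop := forall y, (f z <= f y)%E.

(* F_{mu,oo}(R^n) *)
Definition Fclass mu : set ('rV[R]_n -> \bar R) :=
  [set f | [/\ eclosed f, eproper f, econvex f & strongly_convex mu f]].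

(* M_{mu,oo}(z) *)
Definition Mclass mu z : set ('rV[R]_n -> \bar R) :=
  [set f | Fclass mu f /\ minimizer f z].

(* Empty outside the domain of f. *)
Definition subdiff f x : set 'rV[R]_n :=
  [set g | edom f x /\ forall y, (f x + (dot g (y - x)%R)%:E <= f y)%E].

Definition Mmat mu1 mu2 x x1 x2 (alpha : R) : 'M[R]_3 :=
  let r1 := enorm (x - x1) in
  let r2 := enorm (x - x2) in
  let c := dot (x - x1) (x - x2) / (r1 * r2) in
  \matrix_(i < 3, j < 3)
    nth 0 (nth [::] [:: [:: 1       ; c            ; mu1 * r1      ];
                        [:: c       ; 1            ; - (mu2 * r2)  ];
                        [:: mu1 * r1; - (mu2 * r2) ; alpha         ]] i) j.

End Defs.

(* Main.v *)
Require Import Defs.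
From HB Require Import structures.
From mathcomp Require Import all_boot all_order all_algebra.
From mathcomp Require Import all_classical all_reals all_analysis.
From mathcomp Require Import ring lra.
Import Order.TTheory GRing.Theory Num.Theory.
Import numFieldNormedType.Exports.

Local Open Scope classical_set_scope.
Local Open Scope ring_scope.

(** Put [u = x - x1] and [v = x - x2]. Everything reduces to the existence of
    a vector [g] in the ball of radius [B] with
      [mu1 |u|^2 <= <g, u>]  and  [mu2 |v|^2 <= <- g, v>]
    ([Mclass_sum_minimizerP]).

    These inequalities are necessary: a strongly convex function gains
    [mu / 2 |z - x|^2] over its supporting hyperplane at [x]
    ([subdiff_strongly_convex]), and adding this bound at [x] to the one at the
    minimizer, where 0 is a subgradient, gives [Mclass_subdiff]. They are
    sufficient: if [mu |x - z|^2 <= <g, x - z>], then the quadratic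
    [mu / 2 |y - z|^2] plus the positive part of
    [<g - mu (x - z), y - x>] is [mu]-strongly convex, is minimal at [z] and has
    the subgradient [g] at [x] ([interpolant_Mclass], [interpolant_subdiff]). The
    two functions can be built separately, because opposite subgradients at [x]
    already make [x] a minimizer of their sum.

    What remains is to decide when two half-spaces and a ball centred at 0 have
    a common point ([force_in_ballP]), that is, whether the element of least
    norm of the intersection of the half-spaces has norm at most [B]. The three
    alternatives tell which constraints determine this element. The vector
    [mu1 u] has least norm among those satisfying the first constraint, and the
    first alternative says that it satisfies the second one; the second
    alternative is the mirror image, with [- mu2 v]. Otherwise the minimal vector
    is the solution, in the plane of [u] and [v], of the two equalities, and the
    third alternative bounds its norm; that no vector satisfying the constraints
    is shorter follows from the nonnegativity of the Gram determinant of [g],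
    [u] and [v] ([gram_det_ge0]). Nonnegativity of the determinant of the matrix
    [Mmat] is this norm bound, up to normalization ([det_Mmat_ge0]). *)

(** * Euclidean geometry *)

Section Proof.
Context {R : realType} {n : nat}.
Implicit Types (u v w g : 'rV[R]_n) (a : R).

Lemma dotC u v : dot u v = dot v u.
Proof. by apply: eq_bigr => i _; rewrite mulrC. Qed.

Lemma dotDl u v w : dot (u + v) w = dot u w + dot v w.
Proof. by rewrite -big_split; apply: eq_bigr => i _; rewrite mxE mulrDl. Qed.

Lemma dotZl a u w : dot (a *: u) w = a * dot u w.
Proof. by rewrite mulr_sumr; apply: eq_bigr => i _; rewrite mxE mulrA. Qed.

Lemma dotNl u w : dot (- u) w = - dot u w.
Proof. by rewrite -scaleN1r dotZl mulN1r. Qed.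

Lemma dotDr u v w : dot w (u + v) = dot w u + dot w v.
Proof. by rewrite dotC dotDl !(dotC w). Qed.

Lemma dotZr a u w : dot w (a *: u) = a * dot w u.
Proof. by rewrite dotC dotZl dotC. Qed.

Lemma dotNr u w : dot w (- u) = - dot w u.
Proof. by rewrite dotC dotNl dotC. Qed.

Definition dotE := (dotDl, dotDr, dotNl, dotNr, dotZl, dotZr).

Lemma dot0l w : dot 0 w = 0.
Proof. by rewrite -(scale0r w) dotZl mul0r. Qed.

Lemma dot_ge0 u : 0 <= dot u u.
Proof. by apply: sumr_ge0 => i _; rewrite -expr2 sqr_ge0. Qed.

Lemma dot_eq0 u : dot u u = 0 -> u = 0.
Proof.
move=> /eqP; rewrite psumr_eq0 => [/allP h|i _]; last by rewrite -expr2 sqr_ge0.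
apply/rowP => i; rewrite mxE; apply/eqP.
by have := h i (mem_index_enum _); rewrite mulf_eq0 orbb.
Qed.

Lemma dot_gt0 u : u <> 0 -> 0 < dot u u.
Proof. by move=> u0; rewrite lt0r dot_ge0 andbT; apply/eqP => /dot_eq0. Qed.

Lemma sqr_enorm u : enorm u ^+ 2 = dot u u.
Proof. by rewrite sqr_sqrtr // dot_ge0. Qed.

Lemma enorm_ge0 u : 0 <= enorm u.
Proof. exact: sqrtr_ge0. Qed.

Lemma enorm_le u B : 0 <= B -> (enorm u <= B) = (dot u u <= B ^+ 2).
Proof. by move=> B0; rewrite -sqr_enorm ler_sqr ?nnegrE ?enorm_ge0. Qed.

Lemma enormZ a u : 0 <= a -> enorm (a *: u) = a * enorm u.
Proof.
move=> a0; rewrite /enorm !dotE mulrA -expr2 sqrtrM ?sqr_ge0 //.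
by rewrite sqrtr_sqr ger0_norm.
Qed.

Lemma enormN u : enorm (- u) = enorm u.
Proof. by rewrite /enorm !dotE opprK. Qed.

Lemma cauchy_schwarz u v : dot u v ^+ 2 <= dot u u * dot v v.
Proof.
have [->|/eqP v0] := eqVneq v 0; first by rewrite dotC !dot0l mulr0 expr0n.
have vv := dot_gt0 _ v0.
have := dot_ge0 (dot v v *: u - dot u v *: v).
rewrite !dotE (dotC v u) => h.
rewrite -subr_ge0 -(pmulr_rge0 _ vv).
move: h; congr (is_true (0 <= _)); ring.
Qed.

(** Nonnegativity of the Gram determinant of [g], [u] and [v]: apply
    Cauchy-Schwarz to the components of [g] and [v] orthogonal to [u]. *)
Lemma gram_det_ge0 g u v :
  dot g u ^+ 2 * dot v v + dot g v ^+ 2 * dot u u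
    - 2 * dot g u * dot g v * dot u v
  <= dot g g * (dot u u * dot v v - dot u v ^+ 2).
Proof.
have [->|/eqP u0] := eqVneq u 0.
  by rewrite (dotC g) !dot0l; nra.
have uu := dot_gt0 _ u0.
have := cauchy_schwarz (dot u u *: g - dot g u *: u) (dot u u *: v - dot u v *: u).
rewrite !dotE (dotC u g) (dotC v u) => h.
rewrite -subr_ge0 in h; rewrite -subr_ge0 -(pmulr_rge0 _ uu) -(pmulr_rge0 _ uu) -(pmulr_rge0 _ uu).
move: h; congr (is_true (0 <= _)); ring.
Qed.

(** * Subgradients of strongly convex functions *)

(** The limit [t -> 0] of [(1 - t) * K <= D]. *)
Lemma le_of_convex_slack (K D : R) : 0 <= K ->
  (forall t, 0 < t < 1 -> (1 - t) * K <= D) -> K <= D.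
Proof.
move=> K0 h; rewrite leNgt; apply/negP => DK.
(* [t = 1/2] shows [0 <= D]; the other [t] turns the left-hand side into the
   midpoint of [K] and [D]. *)
have := h 2^-1; have := h ((K - D) / (2 * K)) => h1 h2.
have D0 : 0 <= D by apply: le_trans (h2 _); [apply: mulr_ge0 => //; lra|lra].
have Kp : 0 < K by apply: le_lt_trans DK.
have : 0 < (K - D) / (2 * K) < 1.
  by rewrite divr_gt0 ?ltr_pdivrMr ?mulr_gt0 //=; lra.
move/h1; have -> : (1 - (K - D) / (2 * K)) * K = (K + D) / 2.
  by field; rewrite gt_eqF.
lra.
Qed.

(** Strong convexity bounds [f] along the segment from [x] to [z] by the chord
    minus [mu / 2 * t * (1 - t) * |z - x| ^ 2]; comparing with the supporting
    hyperplane at [x], dividing by [t] and letting [t] tend to 0 gives the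
    quadratic gain. *)
Lemma subdiff_strongly_convex (f : 'rV[R]_n -> \bar R) mu x g z : 0 <= mu ->
  (forall y, f y != -oo%E) -> strongly_convex mu f -> subdiff f x g ->
  (f x + (dot g (z - x) + mu / 2 * dot (z - x) (z - x))%:E <= f z)%E.
Proof.
move=> mu0 fN fsc [domx gx].
have [a fx] : exists a, f x = a%:E.
  by move: domx (fN x); rewrite /edom /=; case: (f x) => // a _ _; exists a.
case fz: (f z) => [b||]; [|by rewrite leey|by have := fN z; rewrite fz].
rewrite fx -EFinD lee_fin -lerBrDl -lerBrDl.
apply: le_of_convex_slack => [|t t01].
  by apply: mulr_ge0 (dot_ge0 _); lra.
have := fsc z x t t01; have := gx (t *: z + (1 - t) *: x).
rewrite fx fz; case: (f _) => [c||]; [|by rewrite -!EFinB -!EFinM -!EFinD addye// leye_eq|by []].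
rewrite -!EFinB -!EFinM -!EFinD !lee_fin !sqr_enorm.
rewrite !dotE (dotC x z) => h1 h2.
move/andP: t01 => [t0 _]; rewrite -(ler_pM2l t0); nra.
Qed.

(** Adding the quadratic lower bound at [x] and the one at the minimizer. *)
Lemma Mclass_subdiff f mu x z g : 0 <= mu ->
  Mclass mu z f -> subdiff f x g -> mu * dot (x - z) (x - z) <= dot g (x - z).
Proof.
move=> mu0 [[_ [fN _] _ fsc] zmin] gx.
have [a fx] : exists a, f x = a%:E.
  by case: gx; move: (fN x); rewrite /edom /=; case: (f x) => // a _ _; exists a.
have z0 : subdiff f z 0.
  split; first by rewrite /edom /= (le_lt_trans (zmin x)) // fx ltry.
  by move=> y; rewrite dot0l adde0.
have := subdiff_strongly_convex f mu x g z mu0 fN fsc gx.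
have := subdiff_strongly_convex f mu z 0 x mu0 fN fsc z0.
move: (fN z) (zmin x); rewrite fx; case: (f z) => [b _ _|_|//]; last by rewrite leye_eq.
rewrite -!EFinD !lee_fin !dotE !dot0l (dotC z x); lra.
Qed.

Lemma subdiff_add_minimizer f1 f2 x g :
  subdiff f1 x g -> subdiff f2 x (- g) -> minimizer (fun y => f1 y + f2 y)%E x.
Proof.
move=> [_ g1] [_ g2] y; have := leeD (g1 y) (g2 y).
by rewrite addeACA dotNl -EFinD subrr adde0.
Qed.

(** * Functions with a prescribed minimizer and subgradient *)

(** The strongly convex quadratic minimal at [z], plus the positive part of the
    affine function vanishing at [x] whose slope corrects the gradient
    [mu *: (x - z)] of the quadratic to [g]. *)
Definition interpolant mu z x g (y : 'rV[R]_n) : R :=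
  mu / 2 * dot (y - z) (y - z) + Num.max 0 (dot (g - mu *: (x - z)) (y - x)).

Lemma continuous_dot (T : topologicalType) (F G : T -> 'rV[R]_n) :
  (forall i, continuous (fun y => F y 0 i)) ->
  (forall i, continuous (fun y => G y 0 i)) ->
  continuous (fun y => dot (F y) (G y)).
Proof.
move=> Fc Gc y; apply: cvg_big => [|i _]; first exact: add_continuous.
by apply: continuousM; [exact: Fc|exact: Gc].
Qed.

Lemma interpolant_continuous mu z x g : continuous (interpolant mu z x g).
Proof.
have sub_cont (c : 'rV[R]_n) (i : 'I_n) : continuous (fun y : 'rV[R]_n => (y - c) 0 i).
  rewrite (_ : (fun y : 'rV[R]_n => _) = fun y => y 0 i - c 0 i).
    move=> y; apply: continuousB; last exact: cst_continuous.
    exact: coord_continuous.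
  by apply/funext => w; rewrite !mxE.
set w := g - mu *: (x - z).
have c1 : continuous (fun y : 'rV[R]_n => dot (y - z) (y - z)).
  by apply: continuous_dot => i; exact: sub_cont.
have c2 : continuous (fun y : 'rV[R]_n => dot w (y - x)).
  by apply: continuous_dot => i; [exact: cst_continuous|exact: sub_cont].
have comb (T : topologicalType) (p q : T -> R) : continuous p -> continuous q ->
    continuous (fun y => mu / 2 * p y + Num.max 0 (q y)).
  move=> pc qc y; apply: cvgD; first by apply: cvgM; [exact: cvg_cst|exact: pc].
  by apply: (@continuous_max R T (cst 0) q y); [exact: cvg_cst|exact: qc].
exact: comb c1 c2.
Qed.

Lemma eclosed_EFin (phi : 'rV[R]_n -> R) :
  continuous phi -> eclosed (EFin \o phi).
Proof.
move=> phic; rewrite /eclosed [X in closed X](_ : _ =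
    (fun p : 'rV[R]_n * R => phi p.1 - p.2) @^-1` [set r | r <= 0]); last first.
  by apply/seteqP; split=> p /=; rewrite lee_fin subr_le0.
have sub_cont (T : topologicalType) (p q : T -> R) :
    continuous p -> continuous q -> continuous (fun y => p y - q y).
  by move=> pc qc y; apply: cvgB; [exact: pc|exact: qc].
have /continuous_closedP : continuous (fun p : 'rV[R]_n * R => phi p.1 - p.2).
  apply: sub_cont => p; last exact: cvg_snd.
  by apply: (@continuous_comp _ _ _ fst phi); [exact: cvg_fst|exact: phic].
by apply; exact: closed_le.
Qed.

Lemma econvex_EFin (phi : 'rV[R]_n -> R) :
  (forall u v t, 0 < t < 1 ->
     phi (t *: u + (1 - t) *: v) <= t * phi u + (1 - t) * phi v) ->
  econvex (EFin \o phi).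
Proof. by move=> h a b t /h /=; rewrite -!EFinM -EFinD lee_fin. Qed.

(** The quadratic part gives an equality, and the positive part is convex. *)
Lemma interpolant_convexity mu z x g (a b : 'rV[R]_n) t : 0 < t < 1 ->
  interpolant mu z x g (t *: a + (1 - t) *: b)
    <= t * interpolant mu z x g a + (1 - t) * interpolant mu z x g b
       - mu / 2 * (t * (1 - t)) * dot (a - b) (a - b).
Proof.
move=> /andP[t0 t1]; rewrite /interpolant; move: (g - _) => w.
have hmax (p q : R) : Num.max 0 (t * p + (1 - t) * q)
    <= t * Num.max 0 p + (1 - t) * Num.max 0 q.
  have t1' : 0 <= 1 - t by lra.
  have [hp1 hp2] : 0 <= Num.max 0 p /\ p <= Num.max 0 p by rewrite !le_max !lexx orbT.
  have [hq1 hq2] : 0 <= Num.max 0 q /\ q <= Num.max 0 q by rewrite !le_max !lexx orbT.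
  by rewrite ge_max; apply/andP; split; nra.
have -> : dot w (t *: a + (1 - t) *: b - x)
    = t * dot w (a - x) + (1 - t) * dot w (b - x) by rewrite !dotE; ring.
have := hmax (dot w (a - x)) (dot w (b - x)); rewrite -subr_ge0 => h.
rewrite -subr_ge0; move: h; congr (is_true (0 <= _)).
by rewrite !dotE (dotC b a) (dotC z a) (dotC z b); field.
Qed.

(** [z] is a minimizer because the interpolant is nonnegative and the hypothesis
    on [g] makes the positive part vanish at [z]. *)
Lemma interpolant_Mclass mu z x g : 0 <= mu ->
  mu * dot (x - z) (x - z) <= dot g (x - z) ->
  Mclass mu z (EFin \o interpolant mu z x g).
Proof.
move=> mu0 gz; split; first split.
- exact: eclosed_EFin (interpolant_continuous _ _ _ _).
- by split=> //; exists 0; rewrite /edom /= ltry.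
- apply: econvex_EFin => a b t t01; apply: le_trans (interpolant_convexity _ _ _ _ _ _ _ t01) _.
  rewrite gerBl; move/andP: t01 => [t0 t1]; rewrite !mulr_ge0 ?dot_ge0 //; lra.
- apply: (econvex_EFin (fun y => interpolant mu z x g y - mu / 2 * enorm y ^+ 2)).
  move=> a b t t01; rewrite !sqr_enorm.
  have := interpolant_convexity mu z x g a b t t01.
  rewrite -subr_ge0 => h; rewrite -subr_ge0; move: h; congr (is_true (0 <= _)).
  by rewrite !dotE (dotC b a); field.
- move=> y; rewrite lee_fin /interpolant subrr dot0l mulr0 add0r.
  apply: (@le_trans _ _ 0).
    by rewrite ge_max lexx /=; move: gz; rewrite !dotE (dotC z x); lra.
  by rewrite addr_ge0 ?le_max ?lexx // mulr_ge0 ?dot_ge0 //; lra.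
Qed.

Lemma interpolant_subdiff mu z x g : 0 <= mu ->
  subdiff (EFin \o interpolant mu z x g) x g.
Proof.
move=> mu0; split=> [|y]; first by rewrite /edom /= ltry.
rewrite -EFinD lee_fin /interpolant subrr [dot _ 0]dotC dot0l maxxx addr0.
set w := g - _.
have : dot w (y - x) <= Num.max 0 (dot w (y - x)) by rewrite le_max lexx orbT.
have : 0 <= mu / 2 * dot (y - x) (y - x) by rewrite mulr_ge0 ?dot_ge0 //; lra.
move: (Num.max _ _) => m; rewrite /w !dotE (dotC z y) (dotC x y) (dotC z x); lra.
Qed.

(** The functions disappear: only the force [g] with which they balance at [x]
    matters. *)
Lemma Mclass_sum_minimizerP mu1 mu2 x1 x2 B x : 0 <= mu1 -> 0 <= mu2 ->
  (exists f1 f2 : 'rV[R]_n -> \bar R,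
     [/\ Mclass mu1 x1 f1,
         Mclass mu2 x2 f2,
         minimizer (fun y => f1 y + f2 y)%E x &
         exists g : 'rV[R]_n,
           [/\ subdiff f1 x g, subdiff f2 x (- g) & enorm g <= B]])
  <->
  exists g : 'rV[R]_n,
    [/\ mu1 * dot (x - x1) (x - x1) <= dot g (x - x1),
        mu2 * dot (x - x2) (x - x2) <= dot (- g) (x - x2) & enorm g <= B].
Proof.
move=> mu10 mu20; split=> [[f1 [f2 [M1 M2 _ [g [s1 s2 gB]]]]]|[g [h1 h2 gB]]].
  by exists g; split=> //; [exact: Mclass_subdiff M1 s1|exact: Mclass_subdiff M2 s2].
exists (EFin \o interpolant mu1 x1 x g), (EFin \o interpolant mu2 x2 x (- g)).
have s1 := interpolant_subdiff mu1 x1 x g mu10.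
have s2 := interpolant_subdiff mu2 x2 x (- g) mu20.
split; [exact: interpolant_Mclass|exact: interpolant_Mclass| |by exists g].
exact: subdiff_add_minimizer s1 s2.
Qed.

(** * Two half-spaces and a ball *)

(** Expanding the determinant and multiplying by [|u|^2 |v|^2] removes the
    normalizations of [u] and [v], so that only dot products remain. *)
Lemma det_Mmat_ge0 mu1 mu2 (x x1 x2 : 'rV[R]_n) alpha : x <> x1 -> x <> x2 ->
  let u := x - x1 in let v := x - x2 in
  (0 <= \det (Mmat mu1 mu2 x x1 x2 alpha)) =
  (dot u u * dot v v * dot (mu1 *: u + mu2 *: v) (mu1 *: u + mu2 *: v)
     <= alpha * (dot u u * dot v v - dot u v ^+ 2)).
Proof.
move=> xx1 xx2 u v.
have u0 : 0 < dot u u by apply: dot_gt0 => /subr0_eq.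
have v0 : 0 < dot v v by apply: dot_gt0 => /subr0_eq.
have p0 : 0 < dot u u * dot v v by rewrite mulr_gt0.
rewrite -[RHS]subr_ge0 -[LHS](pmulr_rge0 _ p0); congr (0 <= _).
rewrite (expand_det_row _ ord0) !big_ord_recl big_ord0 /cofactor.
rewrite !(expand_det_row _ ord0) !big_ord_recl !big_ord0 /cofactor !det_mx11 !mxE /=.
rewrite -/u -/v; clearbody u v; rewrite !dotE (dotC v u) -!sqr_enorm.
have : enorm u != 0 by rewrite -sqrf_eq0 sqr_enorm gt_eqF.
have : enorm v != 0 by rewrite -sqrf_eq0 sqr_enorm gt_eqF.
move: (enorm u) (enorm v) => r s r0 s0.
by field; rewrite r0 s0.
Qed.

(** The inequality of the third alternative bounds by [B] the norm of the
    solution of both equalities; multiplying by the Gram determinant of [u] and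
    [v] lets it make sense when they are collinear. *)
Lemma force_in_ballP (mu1 mu2 B : R) u v : 0 <= mu1 -> 0 <= mu2 -> 0 <= B ->
  (exists g,
    [/\ mu1 * dot u u <= dot g u, mu2 * dot v v <= dot (- g) v & enorm g <= B])
  <->
  [/\ mu1 * enorm u <= B, mu2 * enorm v <= B &
      [\/ mu2 * dot v v <= - (mu1 * dot u v),
          mu1 * dot u u <= - (mu2 * dot u v) |
          [/\ u <> 0, v <> 0 &
             dot u u * dot v v * dot (mu1 *: u + mu2 *: v) (mu1 *: u + mu2 *: v)
               <= B ^+ 2 * (dot u u * dot v v - dot u v ^+ 2)]]].
Proof.
move=> mu10 mu20 B0; split.
- move=> [g [hu hv gB]].
  (* By Cauchy-Schwarz, the half-space of the [h] such that
     [mu * dot w w <= dot h w] is at distance [mu * enorm w] from 0. *)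
  have proj mu w h : 0 <= mu -> enorm h <= B ->
      mu * dot w w <= dot h w -> mu * enorm w <= B.
    move=> mu0 hB hw.
    have [->|/eqP w0] := eqVneq w 0; first by rewrite /enorm dot0l sqrtr0 mulr0.
    have ww := dot_gt0 _ w0; rewrite -enormZ // enorm_le // !dotE.
    rewrite enorm_le // in hB; have := cauchy_schwarz h w => cs.
    have l0 : 0 <= mu * dot w w by rewrite mulr_ge0 ?dot_ge0.
    rewrite -(ler_pM2r ww); apply: le_trans (le_trans _ cs) _.
      have := hw; rewrite -ler_sqr ?nnegrE //; last exact: le_trans hw.
      by apply: le_trans; rewrite le_eqVlt; apply/orP; left; apply/eqP; ring.
    by rewrite ler_pM2r.
  split; [exact: (proj _ _ g)|by apply: (proj _ _ (- g)); rewrite ?enormN|].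
  have [i|ni] := lerP (mu2 * dot v v) (- (mu1 * dot u v)); first by constructor 1.
  have [ii|nii] := lerP (mu1 * dot u u) (- (mu2 * dot u v)); first by constructor 2.
  have u0 : u <> 0 by move=> u0; move: nii; rewrite u0 !dot0l !mulr0 oppr0 ltxx.
  have v0 : v <> 0.
    by move=> v0; move: ni; rewrite v0 (dotC u) !dot0l !mulr0 oppr0 ltxx.
  constructor 3; split=> //.
  have uu := dot_gt0 _ u0; have vv := dot_gt0 _ v0.
  rewrite enorm_le // in gB.
  have D0 : 0 <= dot u u * dot v v - dot u v ^+ 2.
    by rewrite subr_ge0 cauchy_schwarz.
  apply: le_trans (le_trans (gram_det_ge0 g u v) _); last exact: ler_wpM2r.
  (* Passing from [dot g u] and [dot g v] to their extreme values decreases the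
     left-hand side of the Gram inequality: in the slacks [s] and [t], the
     linear terms are nonnegative because the first two alternatives fail, and
     the quadratic ones add up to the square of the norm of [s *: v + t *: u]. *)
  set s := dot g u - mu1 * dot u u; set t := dot (- g) v - mu2 * dot v v.
  have s0 : 0 <= s by rewrite subr_ge0.
  have t0 : 0 <= t by rewrite subr_ge0.
  have su := dot_ge0 (s *: v + t *: u); rewrite !dotE (dotC v u) in su.
  have -> : dot g u = mu1 * dot u u + s by rewrite /s; ring.
  have -> : dot g v = - (mu2 * dot v v + t) by rewrite /t dotNl; ring.
  have c1 : 0 <= s * (dot v v * (mu1 * dot u u + mu2 * dot u v)).
    by rewrite !mulr_ge0 ?dot_ge0 //; lra.
  have c2 : 0 <= t * (dot u u * (mu2 * dot v v + mu1 * dot u v)).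
    by rewrite !mulr_ge0 ?dot_ge0 //; lra.
  rewrite !dotE (dotC v u) -subr_ge0.
  have := addr_ge0 (addr_ge0 c1 c1) (addr_ge0 (addr_ge0 c2 c2) su).
  congr (is_true (0 <= _)); ring.
move=> [uB vB [i|ii|[u0 v0 iii]]].
- by exists (mu1 *: u); split; rewrite ?enormZ // !dotE.
- exists (- (mu2 *: v)); split; rewrite ?enormN ?enormZ // ?opprK !dotE //.
  by rewrite (dotC v u).
have uu := dot_gt0 _ u0; have vv := dot_gt0 _ v0.
have : 0 <= dot u u * dot v v - dot u v ^+ 2 by rewrite subr_ge0 cauchy_schwarz.
rewrite le_eqVlt => /orP[/eqP D0|D0].
  (* In the collinear case the inequality forces [mu1 *: u = - (mu2 *: v)],
     and this common value satisfies both constraints with equality. *)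
  have uv : mu1 *: u + mu2 *: v = 0.
    apply: dot_eq0; apply/eqP; rewrite eq_le dot_ge0 andbT.
    by move: iii; rewrite -D0 mulr0 pmulr_rle0 // mulr_gt0.
  have e : - (mu1 *: u) = mu2 *: v by apply/eqP; rewrite eqr_oppLR -addr_eq0 uv.
  by exists (mu1 *: u); split; rewrite ?enormZ // ?e !dotE.
set D := (X in 0 < X) in D0.
have Dn : D != 0 by rewrite gt_eqF.
(* Cramer's rule for [dot g u = mu1 * dot u u] and
   [dot g v = - (mu2 * dot v v)] with [g = a *: u + b *: v]. *)
pose a := dot v v * (mu1 * dot u u + mu2 * dot u v) / D.
pose b := - (dot u u * (mu2 * dot v v + mu1 * dot u v)) / D.
have gu : dot (a *: u + b *: v) u = mu1 * dot u u.
  by rewrite !dotE (dotC v u) /a /b; move: Dn; rewrite /D => Dn; field.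
have gv : dot (a *: u + b *: v) v = - (mu2 * dot v v).
  by rewrite !dotE /a /b; move: Dn; rewrite /D => Dn; field.
exists (a *: u + b *: v); split; rewrite ?dotNl ?gu ?gv ?opprK //.
rewrite enorm_le // -(ler_pM2r D0); apply: le_trans iii.
rewrite dotDr !dotZr gu gv /a /b !dotE (dotC v u).
by rewrite le_eqVlt; apply/orP; left; apply/eqP; field.
Qed.

End Proof.

(** * The characterization *)

Theorem mainTheorem2 (R : realType) (n : nat) (mu1 mu2 : R)
    (hmu1 : 0 <= mu1) (hmu2 : 0 <= mu2) (hmu : 0 < mu1 + mu2)
    (x1 x2 : 'rV[R]_n) (hx : x1 <> x2)
    (B : R) (hB : mu1 * mu2 / (mu1 + mu2) * enorm (x1 - x2) <= B)
    (x : 'rV[R]_n) :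
  (exists f1 f2 : 'rV[R]_n -> \bar R,
     [/\ Mclass mu1 x1 f1,
         Mclass mu2 x2 f2,
         minimizer (fun y => f1 y + f2 y)%E x &
         exists g : 'rV[R]_n,
           [/\ subdiff f1 x g, subdiff f2 x (- g) & enorm g <= B]])
  <->
  [/\ mu1 * enorm (x - x1) <= B,
      mu2 * enorm (x - x2) <= B &
      [\/ mu1 * dot (x1 - x) (x - x2) >= mu2 * enorm (x - x2) ^+ 2,
          mu2 * dot (x2 - x) (x - x1) >= mu1 * enorm (x - x1) ^+ 2 |
          [/\ x <> x1, x <> x2 & \det (Mmat mu1 mu2 x x1 x2 (B ^+ 2)) >= 0]]].
Proof.
have B0 : 0 <= B.
  by apply: le_trans hB; rewrite !mulr_ge0 ?invr_ge0 ?enorm_ge0 // ltW.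
apply: iff_trans (Mclass_sum_minimizerP _ _ _ _ _ _ hmu1 hmu2) _.
apply: iff_trans (force_in_ballP _ _ _ _ _ hmu1 hmu2 B0) _.
rewrite !sqr_enorm -(opprB x x1) -(opprB x x2) !dotNl !mulrN (dotC (x - x2) (x - x1)).
have sub_neq0 y : x <> y -> x - y <> 0 by move=> ne /subr0_eq.
split=> -[h1 h2 [h|h|[n1 n2 h]]]; split=> //;
  [by constructor 1|by constructor 2|constructor 3|
   by constructor 1|by constructor 2|constructor 3].
- have m1 : x <> x1 by move=> e; apply: n1; rewrite e subrr.
  have m2 : x <> x2 by move=> e; apply: n2; rewrite e subrr.
  by split=> //; rewrite det_Mmat_ge0.
- by split; [exact: sub_neq0|exact: sub_neq0|rewrite -det_Mmat_ge0].
Qed.
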